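(* There exists an absolute constant $C>0$ such that the following holds. Fix $0<\delta<1$. Let $A_1,\ldots,A_D$ be an $s$-sparse family of subsets of $[N]$, and assume that $N=n2^k$ for some positive integers $n$ and $k$. Let $S\subset[N]$ be a random $n$-element subset, chosen uniformly without replacement. Then there is a randomized algorithm that produces an $n$-element subset $Q\subset[N]$ such that \[ \mathbb{E}\,|Q\cap S|\ge n(1-\delta)-2\sqrt n \] and \[ \left|\frac{|A_j\cap Q|}{n}-\frac{|A_j|}{N}\right|\le C\,\frac{\sqrt s}{n}\left(\frac{k}{\delta}+\log(2n)\right)\qquad\text{for each } j=1,\ldots,D. \] The expectation is taken over both the sample $S$ and the internal randomness of the algorithm.
   Context: $[N]=\{1,\ldots,N\}$. A family $A_1,\ldots,A_D$ of subsets of $[N]$ is called $s$-sparse if each point is covered by at most $s$ of the subsets, i.e. $\#\{j: i\in A_j\}\le s$ for each $i\in[N]$. A randomized algorithm is a procedure whose output is a function of its input (here the family $A_1,\ldots,A_D$, the parameters, and the random set $S$) and of auxiliary internal randomness that is independent of $S$; no computational efficiency is claimed. The discrepancy bound holds for every output of the algorithm. *)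

(* Defs.v *)
From mathcomp Require Export all_boot all_order all_algebra.
From mathcomp Require Export all_classical all_reals all_analysis.

Set Implicit Arguments.
Unset Strict Implicit.
Unset Printing Implicit Defensive.

Import Order.TTheory GRing.Theory Num.Theory.
Local Open Scope classical_set_scope.
Local Open Scope ring_scope.

(* The ground set [N] = {1, ..., N} is represented by 'I_N = {0, ..., N - 1}. *)

Definition sparse (N D s : nat) (A : 'I_D -> {set 'I_N}) : Prop :=
  forall i : 'I_N, (#|[pred j : 'I_D | i \in A j]| <= s)%N.

(* A randomized map from inputs in I to outputs in O: a deterministic function
   of the input and of a seed (the internal randomness), which is drawn from
   an arbitrary probability space. O is regarded as a discrete space; it is
   only used for finite O. *)
Record randomized_algorithm (R : realType) (I O : Type) := RandomizedAlgorithm {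
  seed_display : measure_display;
  seed : measurableType seed_display;
  seed_law : probability seed R;
  output : I -> seed -> O;
  output_measurable :
    forall (x : I) (Y : set O), measurable (output x @^-1` Y)
}.

Section RandomInput.
Context {R : realType} {d : measure_display} {Omega : measurableType d}.
Variable P : probability Omega R.

Definition uniform_random_subset (N n : nat) (S : Omega -> {set 'I_N}) : Prop :=
  [/\ forall X : set {set 'I_N}, measurable (S @^-1` X),
      forall w, #|S w| = n
    & forall B : {set 'I_N}, #|B| = n ->
        P (S @^-1` [set B]) = ((('C(N, n))%:R : R)^-1)%:E].

Definition has_law {d' : measure_display} {T : measurableType d'}
    (U : Omega -> T) (mu : probability T R) : Prop :=
  measurable_fun setT U /\
  forall E : set T, measurable E -> P (U @^-1` E) = mu E.

(* Independence of a random element S of a finite (discrete) type and a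
   measurable map U. *)
Definition independent {I : finType} {d' : measure_display}
    {T : measurableType d'} (S : Omega -> I) (U : Omega -> T) : Prop :=
  forall (X : set I) (E : set T), measurable E ->
    P (S @^-1` X `&` U @^-1` E) = (P (S @^-1` X) * P (U @^-1` E))%E.

End RandomInput.

(* Main.v *)
Require Import Defs.
From mathcomp Require Import fingroup perm ring lra.
Import Order.TTheory GRing.Theory Num.Theory.
Local Open Scope ring_scope.

(* Every output is allowed to depend on S, so it suffices that an n-subset has,
   on average, a balanced n-subset within distance delta * n; the output is then
   a balanced set meeting S most.  By symmetrization over the permutations of
   the ground set, this reduces to k rounds of halving, each of which pairs up
   the points and keeps one point of each pair according to a sign vector x.

   A round needs, for a matrix a with columns of squared norm at most t and a
   uniform sign vector x, a sign vector y(x) with all the row sums a_j . y(x) of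
   order sqrt t (1 / delta + log m) and x, y(x) differing in delta * m places on
   average.  By an entropy-type pigeonhole some cell G of density
   exp(- O(delta^2) m) of the cube has row sums that vary by O(sqrt t / delta)
   only.  By concentration of measure a random point is within delta * m of G on
   average.  With Y, Y' the points of G nearest to x and - x, the vector
   (Y - Y') / 2 is a partial coloring with small row sums that almost agrees
   with x; the remaining zeros are colored by iterating the same lemma with
   delta = 1 / 4, and the sign of that second coloring is free, so that it can be
   chosen to agree with x in at least half of the places. *)

Set Implicit Arguments.
Unset Strict Implicit.
Unset Printing Implicit Defensive.

(** * Averages over a finite type *)

Section Mean.
Context {R : realType} {T : finType}.
Implicit Types f g : T -> R.

Definition mean f : R := (\sum_x f x) / #|T|%:R.

Lemma ler_mean f g : (forall x, f x <= g x) -> mean f <= mean g.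
Proof. by move=> fg; rewrite ler_wpM2r ?invr_ge0// ler_sum. Qed.

Lemma meanD f g : mean (fun x => f x + g x) = mean f + mean g.
Proof. by rewrite /mean big_split mulrDl. Qed.

Lemma meanZ c f : mean (fun x => c * f x) = c * mean f.
Proof. by rewrite /mean -mulr_sumr mulrA. Qed.

Lemma mean_bij (h : T -> T) f : bijective h -> mean (f \o h) = mean f.
Proof. by case=> h' hK h'K; rewrite /mean [in RHS](reindex h)//; exists h' => x _. Qed.

Lemma mean_sum (J : Type) (s : seq J) (F : J -> T -> R) :
  mean (fun x => \sum_(j <- s) F j x) = \sum_(j <- s) mean (F j).
Proof. by rewrite /mean exchange_big mulr_suml. Qed.

Lemma mean_cst (x0 : T) c : mean (fun=> c) = c.
Proof.
rewrite /mean sumr_const -(mulr_natr c) mulfK// pnatr_eq0 -lt0n.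
by apply/card_gt0P; exists x0.
Qed.

Lemma mean_le_ex f c : (0 < #|T|)%N -> mean f <= c -> exists x, f x <= c.
Proof.
move=> T0 fc; have [x0 _] := card_gt0P T0; apply/not_existsP => fN.
move: fc; apply/negP; rewrite -ltNge -(mean_cst x0 c) ltr_pM2r ?invr_gt0 ?ltr0n//.
apply: ltr_sum => [|x _]; last by rewrite ltNge; exact/negP.
by apply/hasP; exists x0; rewrite ?mem_index_enum.
Qed.
End Mean.

(** * Exponential moments of Lipschitz functions on the discrete cube *)

Section Cube.
Context {R : realType} {I : finType}.
Local Notation cube := {ffun I -> bool}.
Implicit Types (i j : I) (x y : cube) (f : cube -> R).

Definition flip i x : cube := [ffun j => (j == i) (+) x j].

Lemma flipK i : involutive (flip i).
Proof. by move=> x; apply/ffunP => j; rewrite !ffunE addbA addbb. Qed.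

Lemma flipC i j x : flip i (flip j x) = flip j (flip i x).
Proof. by apply/ffunP => l; rewrite !ffunE addbCA. Qed.

(** Conditional expectation of [f] given all coordinates except [i]. *)
Definition smooth i f x : R := (f x + f (flip i x)) / 2.

Definition lipschitz f := forall i x, `|f x - f (flip i x)| <= 1.

Lemma mean_flip i f : mean (fun x => f (flip i x)) = mean f.
Proof. exact: (mean_bij f (inv_bij (flipK i))). Qed.

Lemma mean_smooth i f : mean (smooth i f) = mean f.
Proof.
rewrite /smooth; under [X in mean X]eq_fun do rewrite mulrC.
by rewrite meanZ meanD mean_flip; field.
Qed.

Lemma smooth_lipschitz i f : lipschitz f -> lipschitz (smooth i f).
Proof.
move=> Lf j x; rewrite /smooth flipC -mulrBl normrM normfV normr_nat.
rewrite ler_pdivrMr// mul1r.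
have -> : f x + f (flip i x) - (f (flip j x) + f (flip j (flip i x))) =
  (f x - f (flip j x)) + (f (flip i x) - f (flip j (flip i x))) by ring.
by apply: le_trans (ler_normD _ _) _; apply: lerD.
Qed.

(** The two exponentials are at most [(1 - u)^-1] and [(1 + u)^-1], whose average is
    [(1 - u ^+ 2)^-1]. *)
Lemma cosh_le (u : R) : `|u| <= 1 / 2 -> (expR u + expR (- u)) / 2 <= expR (2 * u ^+ 2).
Proof.
rewrite ler_norml => /andP[u1 u2].
apply: le_trans (expR_ge1Dx _).
have e1 : expR u <= (1 - u)^-1.
  rewrite -[u in expR u]opprK expRN lef_pV2 ?posrE ?expR_gt0 ?expR_ge1Dx//; lra.
have e2 : expR (- u) <= (1 + u)^-1.
  rewrite expRN lef_pV2 ?posrE ?expR_gt0 ?expR_ge1Dx//; lra.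
have -> : 1 + 2 * u ^+ 2 = (2 + 4 * u ^+ 2) / 2 by field.
rewrite ler_wpM2r// (le_trans (lerD e1 e2))//.
have -> : (1 - u)^-1 + (1 + u)^-1 = 2 / (1 - u ^+ 2).
  have : 1 - u != 0 by lra.
  have : 1 + u != 0 by lra.
  have : 1 - u ^+ 2 != 0 by rewrite expr2; nra.
  by move=> ? ? ?; field; apply/and3P; split.
have u4 : u ^+ 2 <= 1 / 4 by rewrite expr2; nra.
have : 0 <= u ^+ 2 by rewrite sqr_ge0.
set v := u ^+ 2 in u4 *; move=> v0.
rewrite ler_pdivrMr; nra.
Qed.

(** One martingale step: on an edge in direction [i], [l * f] deviates from its average by some [u]
    with [|u| <= l / 2], at the cost of a factor [cosh u <= expR (l ^+ 2 / 2)]. *)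
Lemma mean_expR_smooth (l : R) i f : 0 <= l <= 1 -> lipschitz f ->
  mean (fun x => expR (- l * f x)) <=
  expR (l ^+ 2 / 2) * mean (fun x => expR (- l * smooth i f x)).
Proof.
move=> /andP[l0 l1] Lf; rewrite -(mean_smooth i) -meanZ; apply: ler_mean => x.
set u := l * (f x - f (flip i x)) / 2.
have uE : `|u| <= l / 2.
  by rewrite /u !normrM (ger0_norm l0) normfV normr_nat ler_wpM2r// ler_piMr.
have -> : smooth i (fun y => expR (- l * f y)) x =
    (expR u + expR (- u)) / 2 * expR (- l * smooth i f x).
  rewrite /smooth (mulrAC (expR u + _)) (mulrDl (expR u)) -!expRD addrC.
  by congr ((expR _ + expR _) / _); rewrite /u; field.
rewrite ler_wpM2r ?expR_ge0// (le_trans (cosh_le _))//; first lra.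
rewrite ler_expR -(real_normK (num_real u)).
have : 0 <= `|u| by [].
move: `|u| uE => w wl w0; rewrite !expr2; nra.
Qed.

Lemma flip_invariant_cst f : (forall i x, f (flip i x) = f x) ->
  forall x, f x = mean f.
Proof.
move=> fI; suff fC x y : f x = f y.
  by move=> x; rewrite /mean (eq_bigr (fun=> f x))// -[LHS](mean_cst x).
have [A AE] : exists A : {set I}, A = [set i | x i != y i] by eexists.
have [m mA] := ubnP #|A|; elim: m x A AE mA => // m IHm x A AE mA.
have [/eqP A0|[i iA]] := set_0Vmem A.
  congr f; apply/ffunP => i; apply/eqP; apply/negPn/negP => xy.
  by move/eqP: A0 => /setP/(_ i); rewrite AE !inE xy.
rewrite -(fI i x); apply: (IHm _ (A :\ i)).
  apply/setP => j; rewrite AE !inE ffunE; case: eqP => //= ->.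
  by move: iA; rewrite AE inE; case: (x i) (y i) => -[].
by move: mA; rewrite (cardsD1 i A) iA.
Qed.

(** Smoothing in every coordinate in turn ends at the constant [mean f] and costs
    [expR (l ^+ 2 / 2)] per coordinate. *)
Lemma mean_expR_lipschitz (l : R) f : 0 <= l <= 1 -> lipschitz f ->
  mean (fun x => expR (- l * f x)) <=
  expR (l ^+ 2 / 2 * #|I|%:R) * expR (- l * mean f).
Proof.
move=> l01 Lf; pose F s := foldr smooth f s.
have LF s : lipschitz (F s) by elim: s => //= i s; exact: smooth_lipschitz.
have mF s : mean (F s) = mean f by elim: s => //= i s <-; rewrite mean_smooth.
have FI s i x : i \in s -> F s (flip i x) = F s x.
  elim: s x => //= j s IHs x; rewrite inE => /orP[/eqP->|/IHs Fi].
    by rewrite /smooth flipK addrC.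
  by rewrite /smooth flipC !Fi.
have eF s : mean (fun x => expR (- l * f x)) <=
    expR (l ^+ 2 / 2 * (size s)%:R) * mean (fun x => expR (- l * F s x)).
  elim: s => [|i s IHs]; first by rewrite mulr0 expR0 mul1r.
  rewrite (le_trans IHs)//= -[(size s).+1]addn1 natrD mulrDr mulr1 expRD -(mulrA (expR _)).
  by rewrite ler_wpM2l ?expR_ge0// mean_expR_smooth.
rewrite (le_trans (eF (enum I)))// -cardE ler_wpM2l ?expR_ge0//.
have Fc x : F (enum I) x = mean f.
  by rewrite (@flip_invariant_cst (F (enum I))) ?mF// => i y; rewrite FI ?mem_enum.
by under [X in mean X]eq_fun do rewrite Fc; rewrite (mean_cst [ffun=> false]).
Qed.

Definition hamming x y : nat := (\sum_i (x i != y i))%N.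

Definition nearest (G : {set cube}) x0 x := [arg min_(y < x0 in G) hamming x y].

End Cube.

(** * Mean Hamming distance to a dense subset of the cube *)

Section Transport.
Context {R : realType} {I : finType}.
Local Notation cube := {ffun I -> bool}.
Variables (G : {set cube}) (y0 : cube).
Hypothesis Gy0 : y0 \in G.
Implicit Types x y : cube.

Lemma nearest_in x : nearest G y0 x \in G.
Proof. by rewrite /nearest; case: arg_minnP. Qed.

Lemma nearest_min x y : y \in G -> (hamming x (nearest G y0 x) <= hamming x y)%N.
Proof. by move=> Gy; rewrite /nearest; case: arg_minnP => // z _; apply. Qed.

Lemma hamming_flip i x y : (hamming (flip i x) y <= (hamming x y).+1)%N.
Proof.
rewrite /hamming (bigD1 i)//= [X in (_ <= X.+1)%N](bigD1 i)//= -add1n addnA.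
apply: leq_add; first by rewrite -[1%N]/(nat_of_bool true); do 2 case: (_ != _).
by apply: leq_sum => j /negPf ji; rewrite ffunE ji.
Qed.

Lemma nearest_lipschitz :
  lipschitz (fun x => (hamming x (nearest G y0 x))%:R : R).
Proof.
have le1 i x : (hamming x (nearest G y0 x) <=
    (hamming (flip i x) (nearest G y0 (flip i x))).+1)%N.
  apply: leq_trans (nearest_min _ (nearest_in (flip i x))) _.
  by rewrite -{1}(flipK i x) hamming_flip.
move=> i x; rewrite ler_norml; apply/andP; split.
  have := le1 i (flip i x); rewrite flipK -(ler_nat R) -natr1; lra.
have := le1 i x; rewrite -(ler_nat R) -natr1; lra.
Qed.

(** The distance [f] to [G] vanishes on [G], so the mean of [expR (- l * f)] is at least the density
    of [G]; the concentration bound from above then limits [mean f]. *)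
Lemma mean_hamming_nearest (l h : R) : 0 < l <= 1 ->
  expR (- h) * #|{: cube}|%:R <= #|G|%:R ->
  mean (fun x => (hamming x (nearest G y0 x))%:R : R) <= l / 2 * #|I|%:R + h / l.
Proof.
move=> /andP[l0 l1] hG; set f := fun x => _.
have cube0 : 0 < #|{: cube}|%:R :> R by rewrite ltr0n; apply/card_gt0P; exists y0.
have eG : expR (- h) <= mean (fun x => expR (- l * f x)).
  rewrite /mean ler_pdivlMr// (le_trans hG)//.
  rewrite [leRHS](bigID [in G])/= -sum1_card natr_sum -[leLHS]addr0 lerD//.
    apply: ler_sum => x Gx; rewrite /f.
    suff -> : hamming x (nearest G y0 x) = 0%N by rewrite mulr0 expR0.
    apply/eqP; rewrite -leqn0 (leq_trans (nearest_min _ Gx))// leqn0.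
    by rewrite /hamming big1// => i _; rewrite eqxx.
  by apply: sumr_ge0 => x _; exact: expR_ge0.
have := le_trans eG (@mean_expR_lipschitz _ _ l _ _ nearest_lipschitz).
rewrite (ltW l0) l1 => /(_ isT); rewrite -expRD ler_expR -/f => hl.
rewrite -(ler_pM2l l0) mulrDr [l * (h / l)]mulrC divfK ?gt_eqF//.
by move: hl; rewrite expr2; lra.
Qed.
End Transport.

(** * Second and fourth moments of random signed sums *)

Section Moments.
Context {R : realType} {I : finType}.
Local Notation cube := {ffun I -> bool}.
Implicit Types (x y : cube) (a : I -> R).

Lemma mean_sign_odd (i : I) (g : cube -> R) : (forall x, g (flip i x) = g x) ->
  mean (fun x => g x * (-1) ^+ x i) = 0.
Proof.
move=> gi; set f := fun x => _; suff : mean f = - mean f by lra.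
rewrite -[in LHS](mean_flip i) -mulN1r -meanZ; congr mean; apply/funext => x.
by rewrite /f gi ffunE eqxx signr_addb; ring.
Qed.

Definition signed_sum a x : R := \sum_i a i * (-1) ^+ x i.

(** Adding one sign at a time, the odd powers of the new sign average to zero, and
    [3 * p ^+ 2 + 6 * a i ^+ 2 * p + a i ^+ 4] is at most [3 * (p + a i ^+ 2) ^+ 2]. *)
Lemma signed_sum_moments a : let p := \sum_i a i ^+ 2 in
  mean (fun x => signed_sum a x ^+ 2) = p /\
  mean (fun x => signed_sum a x ^+ 4) <= 3 * p ^+ 2.
Proof.
pose X s x := \sum_(i <- s) a i * (-1) ^+ (x : cube) i : R.
suff main s : uniq s -> let p := \sum_(i <- s) a i ^+ 2 in
    mean (fun x => X s x ^+ 2) = p /\ mean (fun x => X s x ^+ 4) <= 3 * p ^+ 2.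
  have := main (index_enum I) (index_enum_uniq I).
  by rewrite /X.
elim: s => [_|i s IHs /= /andP[is_ us]].
  rewrite /X; under [X in mean X = _]eq_fun do rewrite big_nil expr0n/=.
  under [X in mean X <= _]eq_fun do rewrite big_nil expr0n/=.
  by rewrite !(mean_cst [ffun=> false]) big_nil expr0n mulr0.
have {IHs us} [E2 E4] := IHs us.
have Xi x : X s (flip i x) = X s x.
  rewrite /X !big_seq; apply: eq_bigr => j js; rewrite ffunE.
  by case: eqP js is_ => // -> ->.
have sg2 (x : cube) : ((-1) ^+ x i : R) ^+ 2 = 1 by rewrite sqrr_sign.
rewrite big_cons; set p := \sum_(j <- s) _ in E2 E4 *.
have -> : (fun x => X (i :: s) x ^+ 2) = (fun x => X s x ^+ 2 +
    (2 * a i * (X s x * (-1) ^+ x i) + a i ^+ 2)).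
  apply/funext => x; rewrite /X big_cons -/(X s x).
  have := sg2 x; move: (_ ^+ (x i)) (X s x) => e u e2.
  have -> : (a i * e + u) ^+ 2 = u ^+ 2 + (2 * a i * (u * e) +
      a i ^+ 2 * e ^+ 2) by ring.
  by rewrite e2 mulr1.
have -> : (fun x => X (i :: s) x ^+ 4) = (fun x => X s x ^+ 4 +
    (4 * a i * (X s x ^+ 3 * (-1) ^+ x i) + (6 * a i ^+ 2 * X s x ^+ 2 +
    (4 * a i ^+ 3 * (X s x * (-1) ^+ x i) + a i ^+ 4)))).
  apply/funext => x; rewrite /X big_cons -/(X s x).
  have := sg2 x; move: (_ ^+ (x i)) (X s x) => e u e2.
  have -> : (a i * e + u) ^+ 4 = u ^+ 4 + (4 * a i * (u ^+ 3 * e) +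
      (6 * a i ^+ 2 * u ^+ 2 * e ^+ 2 + (4 * a i ^+ 3 * (u * e) * e ^+ 2 +
      a i ^+ 4 * (e ^+ 2) ^+ 2))) by ring.
  by rewrite e2 expr1n !mulr1.
rewrite !(meanD, meanZ) !mean_sign_odd ?(mean_cst [ffun=> false])//; last first.
  by move=> x; rewrite Xi.
rewrite E2; split; first ring.
have := sqr_ge0 (a i ^+ 2); lra.
Qed.
End Moments.

(** * Weighted pigeonhole for the level cells of one function *)

Section Pigeonhole.
Context {R : realType} {T : finType}.
Implicit Types (f : T -> R) (G : {set T}).

Lemma sum_inv_sqr_le2 (M : nat) : \sum_(k < M) (k.+1%:R ^+ 2)^-1 <= 2 :> R.
Proof.
case: M => [|M]; first by rewrite big_ord0.
(* The sharper bound makes the induction telescope. *)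
suff : \sum_(k < M.+1) (k.+1%:R ^+ 2)^-1 <= 2 - M.+1%:R^-1 :> R.
  by move=> /le_trans; apply; rewrite gerBl.
elim: M => [|M IHM]; first by rewrite big_ord1 expr1n invr1; lra.
rewrite big_ord_recr/= (le_trans (lerD IHM (lexx _)))//.
have M0 : 0 < M.+1%:R :> R by rewrite ltr0n.
rewrite -[M.+2%:R]natr1; move: (M.+1%:R : R) M0 => u u0.
have -> : ((u + 1) ^+ 2)^-1 = (u + 1)^-1 ^+ 2 by rewrite exprVn.
have uv : u^-1 - (u + 1)^-1 = u^-1 * (u + 1)^-1.
  by field; apply/andP; split; lra.
have : (u + 1)^-1 <= u^-1 by rewrite lef_pV2 ?posrE; lra.
have : 0 <= (u + 1)^-1 by rewrite invr_ge0; lra.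
move: uv; move: (u^-1) ((u + 1)^-1) => v w; rewrite expr2; nra.
Qed.

Lemma sum_expR_pow4_le (M : nat) (h : R) : 0 < h ->
  \sum_(k < M) expR (- (k.+1%:R ^+ 4 / h)) <= 2 * h.
Proof.
move=> h0; rewrite [leRHS]mulrC.
apply: (@le_trans _ _ (h * \sum_(k < M) (k.+1%:R ^+ 2)^-1)); last first.
  by rewrite ler_wpM2l ?(ltW h0)// sum_inv_sqr_le2.
rewrite mulr_sumr; apply: ler_sum => k _.
have k0 : 0 < k.+1%:R ^+ 4 / h :> R by rewrite divr_gt0// exprn_gt0// ltr0n.
rewrite expRN; apply: (@le_trans _ _ (k.+1%:R ^+ 4 / h)^-1).
  by rewrite lef_pV2 ?posrE ?expR_gt0// (le_trans _ (expR_ge1Dx _))// lerDr.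
rewrite invf_div ler_wpM2l ?(ltW h0)// lef_pV2 ?posrE ?exprn_gt0 ?ltr0n//.
by rewrite ler_weXn2l// ler1n.
Qed.

(* The weight [expR (- n ^ 4 / h)] of the cell [n] replaces the entropy of the
   cell partition: the mean of the exponent is controlled by the fourth moment
   of [f], while the total weight of all the cells is [1 + O(h)]. *)
Lemma cell_pigeonhole f (W : T -> R) G (b h : R) : 0 < b -> 0 <= h ->
  (h = 0 -> forall x, f x = 0) -> (forall x, 0 <= W x) ->
  exists G' : {set T}, [/\ G' \subset G,
    forall x y, x \in G' -> y \in G' -> `|f x - f y| <= 2 * b &
    \sum_(x in G) W x * expR (- ((f x / b) ^+ 4 / h)) <=
      (1 + 4 * h) * \sum_(x in G') W x].
Proof.
move=> b0; rewrite le_eqVlt => /orP[/eqP<- /(_ erefl) f0 W0|h0 _ W0].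
  exists G; split => // [x y _ _|]; first by rewrite !f0 subrr normr0; lra.
  rewrite mulr0 addr0 mul1r le_eqVlt; apply/orP; left; apply/eqP.
  by apply: eq_bigr => x _; rewrite invr0 mulr0 oppr0 expR0 mulr1.
pose n x := Num.truncn (`|f x| / b).
pose M := \max_x n x.
(* The sign is recorded only when [n x] is positive, so the values of size below [b] form one cell,
   of diameter at most [2 * b]. *)
pose q x : bool * 'I_M.+1 := ((0 < n x)%N && (f x < 0), inord (n x)).
have nq x : (q x).2 = n x :> nat.
  by rewrite /= inordK// ltnS (leq_bigmax x).
pose S c := \sum_(x in G | q x == c) W x.
have S0 c : 0 <= S c by apply: sumr_ge0.
(* The cell to keep is the one of largest [W]-mass. *)
have [c0 _ c0max] := arg_maxP S (isT : xpredT (false, ord0 : 'I_M.+1)).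
have nle x : (n x)%:R <= `|f x| / b by rewrite truncn_le divr_ge0// ltW.
have ltn x : `|f x| / b < (n x)%:R + 1 by rewrite natr1 -truncn_le_nat.
exists [set x in G | q x == c0]; split.
- by apply/fintype.subsetP => x; rewrite inE => /andP[].
- move=> x y; rewrite !inE => /andP[_ /eqP qx] /andP[_ /eqP qy].
  have nxy : n x = n y by rewrite -!nq qx qy.
  have sxy : ((0 < n x)%N && (f x < 0)) = ((0 < n y)%N && (f y < 0)).
    by rewrite -[LHS]/(q x).1 -[RHS]/(q y).1 qx qy.
  have := ltn x; have := nle x; have := ltn y; have := nle y; rewrite -nxy in sxy *.
  rewrite !ltr_pdivrMr// !ler_pdivlMr//.
  have [n0|n0] := posnP (n x).
    rewrite n0 !(mul0r, add0r, mul1r) => _ fy _ fx.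
    by rewrite (le_trans (ler_normB _ _))//; lra.
  rewrite n0 /= in sxy; set u := (n x)%:R * b; rewrite mulrDl mul1r -/u.
  case: (ltrP (f x) 0) sxy => fx /esym => [fy|/negbT]; last rewrite -leNgt => fy.
    rewrite (ltr0_norm fx) (ltr0_norm fy) => *; rewrite ler_norml; apply/andP; split; lra.
  rewrite (ger0_norm fx) (ger0_norm fy) => *; rewrite ler_norml; apply/andP; split; lra.
have -> : \sum_(x in [set x in G | q x == c0]) W x = S c0.
  by apply: eq_bigl => x; rewrite inE.
(* [q] never takes the value [(true, ord0)]; with weight zero there, the total weight is 1 plus
   twice a sum bounded by [2 * h]. *)
pose w (c : bool * 'I_M.+1) : R :=
  if c.1 && (c.2 == ord0) then 0 else expR (- ((c.2 : nat)%:R ^+ 4 / h)).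
have w0 c : 0 <= w c by rewrite /w; case: ifP => // _; exact: expR_ge0.
apply: (@le_trans _ _ (\sum_c w c * S c)).
  rewrite (partition_big q xpredT)//=; apply: ler_sum => c _.
  rewrite /S mulr_sumr; apply: ler_sum => x /andP[_ /eqP <-].
  rewrite mulrC ler_wpM2r// /w; case: ifP => [/andP[/= /andP[nx _] /eqP]|_].
    by move=> /(congr1 val)/=; rewrite -[inord _]/(q x).2 nq => nx0; rewrite nx0 in nx.
  rewrite ler_expR lerN2 ler_wpM2r ?invr_ge0 ?(ltW h0)// nq.
  rewrite -(@ger0_norm _ ((f x / b) ^+ 4)) ?exprn_even_ge0// normrX.
  apply: lerXn2r; rewrite ?nnegrE//.
  by rewrite normrM normfV (gtr0_norm b0).
apply: (@le_trans _ _ (\sum_c w c * S c0)).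
  by apply: ler_sum => c _; rewrite ler_wpM2l//; exact: c0max.
rewrite -mulr_suml ler_wpM2r//.
have -> : \sum_c w c = \sum_d \sum_k w (d, k).
  by rewrite pair_bigA; apply: eq_bigr => -[].
rewrite big_bool/= !big_ord_recl /w/= expr0n/= mul0r oppr0 expR0 add0r.
have := @sum_expR_pow4_le M h h0; lra.
Qed.
End Pigeonhole.

(** * A dense set on which all row sums are nearly constant *)

Section DenseCell.
Context {R : realType} {I J : finType}.
Local Notation cube := {ffun I -> bool}.
Variables (a : J -> I -> R) (t : R).
Hypothesis at2 : forall i, \sum_j a j i ^+ 2 <= t.

(** The pigeonhole is applied row by row, the exponential factors of the rows still to come serving
    as [W]; the losses [1 + 4 * h j] multiply to at most the exponential on the right. *)
Lemma common_cell (b : R) (s : seq J) (G : {set cube}) : 0 < b ->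
  exists2 G' : {set cube}, G' \subset G &
    (forall j x y, j \in s -> x \in G' -> y \in G' ->
      `|signed_sum (a j) x - signed_sum (a j) y| <= 2 * b) /\
    \sum_(x in G) expR (- \sum_(j <- s)
      (signed_sum (a j) x / b) ^+ 4 / ((\sum_i a j i ^+ 2) / b ^+ 2)) <=
    expR (4 * \sum_(j <- s) (\sum_i a j i ^+ 2) / b ^+ 2) * #|G'|%:R.
Proof.
move=> b0; elim: s G => [|j s IHs] G.
  exists G => //; split => //; rewrite !big_nil mulr0 expR0 mul1r -sum1_card natr_sum.
  by apply: ler_sum => x _; rewrite big_nil oppr0 expR0.
set h := fun j => (\sum_i a j i ^+ 2) / b ^+ 2.
pose e j x := (signed_sum (a j) x / b) ^+ 4 / h j.
have h0 : 0 <= h j.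
  by rewrite divr_ge0 ?exprn_ge0 ?(ltW b0)// sumr_ge0// => i _; exact: sqr_ge0.
have hz : h j = 0 -> forall x, signed_sum (a j) x = 0.
  move/eqP; rewrite mulf_eq0 invr_eq0 expf_eq0/= (gt_eqF b0) orbF.
  rewrite psumr_eq0 => [/allP aj0 x|i _]; last exact: sqr_ge0.
  apply: big1 => i _; have := aj0 i (mem_index_enum i).
  by rewrite sqrf_eq0 => /eqP ->; rewrite mul0r.
have W0 x : 0 <= expR (- \sum_(j <- s) e j x) by exact: expR_ge0.
have [G1 [G1G G1f G1W]] := cell_pigeonhole G b0 h0 hz W0.
have [G2 G2G1 [G2f G2W]] := IHs G1.
exists G2; first exact: fintype.subset_trans G2G1 G1G.
split.
  move=> l x y; rewrite inE => /orP[/eqP->|]; last exact: G2f.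
  by move=> /(fintype.subsetP G2G1) xG1 /(fintype.subsetP G2G1) yG1; exact: G1f.
rewrite big_cons; under [leLHS]eq_bigr do rewrite big_cons opprD expRD mulrC.
rewrite (le_trans G1W)// mulrDr expRD -mulrA ler_pM//.
- by rewrite addr_ge0// mulr_ge0.
- exact: sumr_ge0.
- exact: expR_ge1Dx.
Qed.

(** The 7 is 3 + 4: 3 from the fourth moments through Jensen's inequality, 4 from the losses in
    [common_cell]. Exchanging sums turns the column bound [t] into a bound on the sum of all squared
    row norms. *)
Lemma dense_cell (b : R) : 0 < b -> exists G : {set cube},
  (forall j x y, x \in G -> y \in G ->
    `|signed_sum (a j) x - signed_sum (a j) y| <= 2 * b) /\
  expR (- (7 * (t * #|I|%:R / b ^+ 2))) * #|{: cube}|%:R <= #|G|%:R.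
Proof.
move=> b0; have [G _ [Gf GW]] := common_cell (index_enum J) [set: cube] b0.
exists G; split => [j x y|]; first by apply: Gf; rewrite mem_index_enum.
set h := fun j => (\sum_i a j i ^+ 2) / b ^+ 2.
have h0 j : 0 <= h j.
  by rewrite divr_ge0 ?exprn_ge0 ?(ltW b0)// sumr_ge0// => i _; exact: sqr_ge0.
pose L x := \sum_j (signed_sum (a j) x / b) ^+ 4 / h j.
have b4 : 0 < b ^+ 4 by rewrite exprn_gt0.
have LE : mean L <= 3 * \sum_j h j.
  rewrite mean_sum mulr_sumr; apply: ler_sum => j _.
  have -> : (fun x => (signed_sum (a j) x / b) ^+ 4 / h j) =
      (fun x => (b ^+ 4)^-1 / h j * signed_sum (a j) x ^+ 4).
    by apply/funext => x; rewrite expr_div_n; ring.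
  have [_ E4] := signed_sum_moments (a j); rewrite meanZ.
  have [->|hj] := eqVneq (h j) 0; first by rewrite invr0 !(mulr0, mul0r).
  rewrite (@le_trans _ _ ((b ^+ 4)^-1 / h j * (3 * (\sum_i a j i ^+ 2) ^+ 2)))//.
    by rewrite ler_wpM2l// divr_ge0// invr_ge0 ltW.
  rewrite le_eqVlt; apply/orP; left; apply/eqP.
  have -> : (\sum_i a j i ^+ 2) = h j * b ^+ 2 by rewrite divfK// expf_eq0 gt_eqF.
  by field; rewrite hj gt_eqF.
have hT : \sum_j h j <= t * #|I|%:R / b ^+ 2.
  rewrite -mulr_suml ler_wpM2r ?invr_ge0 ?exprn_ge0 ?(ltW b0)// exchange_big/=.
  rewrite (le_trans (ler_sum _ (fun i _ => at2 i)))// sumr_const -(mulr_natr t).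
  by rewrite le_eqVlt eqxx.
have jensen : expR (- (3 * \sum_j h j)) * #|{: cube}|%:R <= \sum_x expR (- L x).
  have c0 : 0 < #|{: cube}|%:R :> R.
    by rewrite ltr0n; apply/card_gt0P; exists [ffun=> false].
  rewrite -ler_pdivlMr// -/(mean _).
  apply: (@le_trans _ _ (expR (- mean L))); first by rewrite ler_expR lerN2.
  (* Jensen's inequality, by the tangent of the exponential at [- mean L]. *)
  have -> : expR (- mean L) = mean (fun x => expR (- mean L) * (1 + (mean L + (-1) * L x))).
    rewrite meanZ !(meanD, meanZ) !(mean_cst ([ffun=> false] : cube)) -/(mean L); ring.
  apply: ler_mean => x.
  have -> : - L x = - mean L + (mean L + (-1) * L x) by ring.
  by rewrite expRD ler_wpM2l ?expR_ge0// expR_ge1Dx.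
have : expR (- (3 * \sum_j h j)) * #|{: cube}|%:R <=
    expR (4 * \sum_j h j) * #|G|%:R.
  apply: le_trans jensen (le_trans _ GW).
  by rewrite le_eqVlt; apply/orP; left; apply/eqP; apply: eq_bigl => x; rewrite inE.
rewrite -(ler_pM2l (expR_gt0 (- (4 * \sum_j h j)))) !mulrA -!expRD addNr expR0 mul1r.
by apply: le_trans; rewrite ler_wpM2r// ler_expR; move: hT; lra.
Qed.

End DenseCell.

(** * Pairs of points with close row sums, near a random point and its antipode *)

Definition opp_cube (I : finType) (x : {ffun I -> bool}) : {ffun I -> bool} :=
  [ffun i => ~~ x i].

Lemma opp_cubeK (I : finType) : involutive (@opp_cube I).
Proof. by move=> x; apply/ffunP => i; rewrite !ffunE negbK. Qed.

Lemma signed_sum_opp (R : realType) (I : finType) (a : I -> R) (x : {ffun I -> bool}) :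
  signed_sum a (opp_cube x) = - signed_sum a x.
Proof.
by rewrite /signed_sum -sumrN; apply: eq_bigr => i _; rewrite ffunE signrN mulrN.
Qed.

Section NearPairs.
Context {R : realType} {I J : finType}.
Local Notation cube := {ffun I -> bool}.
Variables (a : J -> I -> R) (t : R).
Hypothesis t0 : 0 <= t.
Hypothesis at2 : forall i, \sum_j a j i ^+ 2 <= t.

(** [Y x] and [Y' x] are the points of a dense cell nearest to [x] and to its antipode; the
    antipodal map preserves means, so both distances have the same average. *)
Lemma near_pairs (delta : R) : 0 < delta <= 1 -> exists Y Y' : cube -> cube,
  (forall j x, `|signed_sum (a j) (Y x) - signed_sum (a j) (Y' x)| <=
     2 * (Num.sqrt (14 * t) / delta)) /\
  mean (fun x => (hamming x (Y x) + hamming (opp_cube x) (Y' x))%:R : R) <=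
    2 * delta * #|I|%:R.
Proof.
move=> /andP[d0 d1].
suff [G [y0 [Gy0 Gb Gm]]] : exists (G : {set cube}) y0, [/\ y0 \in G,
    forall j x y, x \in G -> y \in G -> `|signed_sum (a j) x - signed_sum (a j) y| <=
       2 * (Num.sqrt (14 * t) / delta) &
    mean (fun x => (hamming x (nearest G y0 x))%:R : R) <= delta * #|I|%:R].
  exists (nearest G y0), (fun x => nearest G y0 (opp_cube x)); split.
    by move=> j x; apply: Gb; exact: nearest_in.
  under [X in mean X]eq_fun do rewrite natrD.
  rewrite meanD (mean_bij (fun x => (hamming x (nearest G y0 x))%:R)
    (inv_bij (@opp_cubeK I))); lra.
(* For [t = 0] the width [b] below would be zero; but then [a] vanishes and the whole cube is a
   cell. *)
move: t0; rewrite le_eqVlt => /orP[/eqP t00|tp].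
  have a0 j i : a j i = 0.
    have : \sum_j a j i ^+ 2 == 0.
      by rewrite eq_le [X in _ <= X]t00 at2 sumr_ge0// => l _; exact: sqr_ge0.
    rewrite psumr_eq0 => [/allP/(_ j (mem_index_enum j))|l _]; last exact: sqr_ge0.
    by rewrite sqrf_eq0 => /eqP.
  exists [set: cube]%SET, [ffun=> false]; split; first by rewrite inE.
    move=> j x y _ _; rewrite /signed_sum !big1 => [|i _|i _]; rewrite ?a0 ?mul0r//.
    by rewrite subrr normr0 mulr_ge0// divr_ge0 ?sqrtr_ge0// ltW.
  have N0 x : hamming x (nearest [set: cube]%SET [ffun=> false] x) = 0%N.
    apply/eqP; rewrite -leqn0.
    have := @nearest_min _ [set: cube]%SET [ffun=> false]
      (finset.in_setT _) x x (finset.in_setT _).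
    by rewrite {2}/hamming big1// => i _; rewrite eqxx.
  under [X in mean X]eq_fun do rewrite N0.
  by rewrite (mean_cst ([ffun=> false] : cube)) mulr_ge0// ltW.
(* This makes the exponent of [dense_cell] equal to [delta ^+ 2 * #|I| / 2], so that taking
   [l = delta] in [mean_hamming_nearest] gives two halves of [delta * #|I|]. *)
pose b := Num.sqrt (14 * t) / delta.
have b0 : 0 < b by rewrite divr_gt0// sqrtr_gt0 mulr_gt0.
have b2 : b ^+ 2 = 14 * t / delta ^+ 2.
  by rewrite expr_div_n sqr_sqrtr// mulr_ge0// ltW.
have [G [Gb GE]] := dense_cell at2 b0.
have [y0 Gy0] : exists y0, y0 \in G.
  apply/set0Pn; rewrite -card_gt0 -(ltr0n R); apply: lt_le_trans GE.
  rewrite mulr_gt0 ?expR_gt0// ltr0n; apply/card_gt0P; by exists [ffun=> false].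
exists G, y0; split => //.
have d01 : 0 < delta <= 1 by rewrite d0.
apply: le_trans (mean_hamming_nearest Gy0 d01 GE) _.
rewrite b2 le_eqVlt; apply/orP; left; apply/eqP; field.
by rewrite !gt_eqF.
Qed.

End NearPairs.

(** * Completing a partial coloring *)

Section Merge.
Context {R : realType} {I : finType}.
Local Notation cube := {ffun I -> bool}.
Variables (Y Y' : cube).

(** The zeros of the partial coloring [(Y - Y') / 2], read in signs. *)
Definition agree : {set I} := [set i | Y i == Y' i].
Local Notation sub := {i : I | i \in agree}.
Implicit Types chi : {ffun sub -> bool}.

Definition merge chi : cube :=
  [ffun i => if insub i is Some d then chi d else Y i].

Lemma merge_in chi (d : sub) : merge chi (val d) = chi d.
Proof. by rewrite ffunE valK. Qed.

Lemma merge_notin chi i : i \notin agree -> merge chi i = Y i.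
Proof. by move=> iD; rewrite ffunE insubN. Qed.

Lemma notin_agree i : i \notin agree -> Y' i = ~~ Y i.
Proof. by rewrite inE; case: (Y i) (Y' i) => -[]. Qed.

Lemma signed_sum_merge (a : I -> R) chi :
  signed_sum a (merge chi) =
  (signed_sum a Y - signed_sum a Y') / 2 + signed_sum (a \o val) chi.
Proof.
rewrite {1}/signed_sum (bigID [in agree])/= addrC; congr (_ + _); last first.
  by rewrite big_sub; apply: eq_bigr => d _; rewrite merge_in.
rewrite /signed_sum -sumrB mulr_suml [RHS](bigID [in agree])/= [X in _ = X + _]big1 ?add0r.
  apply: eq_bigr => i iD; rewrite merge_notin// notin_agree// signrN; by field.
by move=> i; rewrite inE => /eqP ->; rewrite subrr mul0r.
Qed.

(** A common value of [Y] and [Y'] at [i] differs from exactly one of [x i] and its negation. *)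
Lemma card_agree x : (#|agree| <= hamming x Y + hamming (opp_cube x) Y')%N.
Proof.
rewrite -sum1_card /hamming -big_split/= big_mkcond/=; apply: leq_sum => i _.
by rewrite inE ffunE; case: (Y i) (Y' i) (x i) => -[] [].
Qed.

(** On [agree], one of [chi] and its opposite matches [x] in at least half of the places; elsewhere
    a place where [x] and [Y] differ is counted twice on the right. *)
Lemma hamming_merge x chi :
  exists2 chi', chi' = chi \/ chi' = opp_cube chi &
    (2 * hamming x (merge chi') <= hamming x Y + hamming (opp_cube x) Y')%N.
Proof.
pose h c := (\sum_(d : sub) (x (val d) != (c : {ffun sub -> bool}) d))%N.
have hh : (h chi + h (opp_cube chi) = #|agree|)%N.
  rewrite /h -big_split/= -[RHS]sum1_card [RHS]big_sub; apply: eq_bigr => d _.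
  by rewrite ffunE; case: (x _) (chi d) => -[].
have [chi' chiE hchi] : exists2 chi', chi' = chi \/ chi' = opp_cube chi &
    (2 * h chi' <= #|agree|)%N.
  have [le|lt] := leqP (h chi) (h (opp_cube chi)).
    by exists chi; [left|rewrite -hh mul2n -addnn leq_add2l].
  by exists (opp_cube chi); [right|rewrite -hh mul2n -addnn leq_add2r ltnW].
exists chi' => //.
rewrite {1}/hamming (bigID [in agree])/= mulnDr.
rewrite /hamming -big_split/= [leqRHS](bigID [in agree])/=; apply: leq_add.
  rewrite big_sub/=; under eq_bigr do rewrite merge_in.
  apply: leq_trans hchi _; rewrite -sum1_card; apply: leq_sum => i.
  by rewrite inE ffunE; case: (Y i) (Y' i) (x i) => -[] [].
rewrite big_distrr/=; apply: leq_sum => i iD.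
by rewrite merge_notin// notin_agree// ffunE; case: (Y i) (x i) => -[].
Qed.
End Merge.

(** * Full colorings, and rounding of a random sign vector *)

Section Coloring.
Context {R : realType} {J : finType}.
Variable t : R.
Hypothesis t0 : 0 <= t.
Let K := Num.sqrt (14 * t).

(** With [delta = 1 / 4] each partial coloring leaves at most half of the points uncolored and adds
    at most [4 * K] to a row sum. *)
Lemma full_coloring (r : nat) (I : finType) (a : J -> I -> R) :
  (forall i, \sum_j a j i ^+ 2 <= t) -> (#|I| < 2 ^ r)%N ->
  exists chi : {ffun I -> bool}, forall j, `|signed_sum (a j) chi| <= 4 * r%:R * K.
Proof.
elim: r I a => [|r IHr] I a at2.
  rewrite expn0 ltnS leqn0 => /eqP/card0_eq I0; exists [ffun=> false] => j.
  by rewrite /signed_sum big1 ?normr0 ?mulr0 ?mul0r// => i; have := I0 i; rewrite inE.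
move=> Ir; have quarter : 0 < (1 / 4 : R) <= 1 by apply/andP; split; lra.
have [Y [Y' [Yb Ym]]] := near_pairs t0 at2 quarter.
have [|x hx] := mean_le_ex _ Ym.
  by apply/card_gt0P; exists [ffun=> false].
have Dr : (#|agree (Y x) (Y' x)| < 2 ^ r)%N.
  rewrite -(ltn_pmul2l (isT : 0 < 2)%N) -expnS; apply: leq_ltn_trans Ir.
  rewrite -(ler_nat R) natrM.
  have := card_agree (Y x) (Y' x) x; rewrite -(ler_nat R); lra.
pose I' := {i | i \in agree (Y x) (Y' x)}.
have [||chi chib] := IHr I' (fun j => a j \o val).
- by move=> i; exact: at2.
- rewrite card_sig; apply: leq_ltn_trans Dr; rewrite leq_eqVlt.
  by apply/orP; left; apply/eqP/eq_card => i; rewrite inE.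
exists (merge chi) => j; rewrite signed_sum_merge.
rewrite (le_trans (ler_normD _ _))// normrM normfV normr_nat -[r.+1]addn1 natrD.
have := Yb j x; have := chib j; rewrite -/K; lra.
Qed.

(** The partial coloring contributes [K / delta], and the coloring of its zeros contributes
    [4 * r * K], with its sign chosen in favor of [x]. *)
Lemma rounding (r : nat) (I : finType) (a : J -> I -> R) (delta : R) :
  (forall i, \sum_j a j i ^+ 2 <= t) -> (#|I| < 2 ^ r)%N -> 0 < delta <= 1 ->
  exists y : {ffun I -> bool} -> {ffun I -> bool},
    (forall j x, `|signed_sum (a j) (y x)| <= K * (delta^-1 + 4 * r%:R)) /\
    mean (fun x => (hamming x (y x))%:R : R) <= delta * #|I|%:R.
Proof.
move=> at2 Ir d01; have [Y [Y' [Yb Ym]]] := near_pairs t0 at2 d01.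
have /choice[y yP] : forall x, exists y : {ffun I -> bool},
    (forall j, `|signed_sum (a j) y| <= K * (delta^-1 + 4 * r%:R)) /\
    (2 * hamming x y <= hamming x (Y x) + hamming (opp_cube x) (Y' x))%N.
  move=> x; pose I' := {i | i \in agree (Y x) (Y' x)}.
  have [||chi chib] := @full_coloring r I' (fun j => a j \o val).
  - by move=> i; exact: at2.
  - apply: leq_ltn_trans Ir; rewrite card_sig; exact: max_card.
  have [chi' chiE hchi] := hamming_merge x chi.
  exists (merge chi'); split => // j; rewrite signed_sum_merge.
  rewrite (le_trans (ler_normD _ _))// normrM normfV normr_nat.
  have -> : `|signed_sum (a j \o val) chi'| = `|signed_sum (a j \o val) chi|.
    by case: chiE => -> //; rewrite signed_sum_opp normrN.
  have := Yb j x; have := chib j; rewrite -/K; lra.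
exists y; split; first by move=> j x; have [] := yP x.
rewrite -(ler_pM2l (ltr0Sn R 1)) -meanZ mulrA (le_trans _ Ym)//.
apply: ler_mean => x; have [_] := yP x.
by rewrite -(ler_nat R) natrM.
Qed.
End Coloring.

(** * Averages over permutations and over subsets of fixed size *)

Section Symmetrization.
Context {R : realType} {E : finType}.
Implicit Types (T B D : {set E}) (F : {set E} -> R).

(** List each set followed by its complement, and match the two lists by position. *)
Lemma perm_imset_eq T T' : #|T| = #|T'| -> exists rho : {perm E}, T' = rho @: T.
Proof.
move=> TT'; pose l (B : {set E}) := enum B ++ enum (~: B).
have ul B : uniq (l B).
  rewrite cat_uniq !enum_uniq andbT/=; apply/hasPn => x.
  by rewrite !mem_enum inE.
have ml B x : x \in l B by rewrite mem_cat !mem_enum inE orbN.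
have sl B : size (l B) = #|E| by rewrite size_cat -!cardE cardsC.
pose f x := nth x (l T') (index x (l T)).
have ix x : (index x (l T) < size (l T'))%N by rewrite sl -(sl T) index_mem.
have f_inj : injective f.
  move=> x y; rewrite /f (set_nth_default x y) // => /eqP.
  rewrite nth_uniq// => /eqP xy.
  by rewrite -(nth_index x (ml T x)) xy nth_index.
exists (perm f_inj); apply/esym/eqP; rewrite eqEcard card_imset; last exact: perm_inj.
rewrite TT' leqnn andbT; apply/fintype.subsetP => _ /imsetP[x xT ->].
rewrite permE /f /l index_cat mem_enum xT nth_cat -cardE -TT' cardE index_mem.
rewrite mem_enum xT -(mem_enum T') mem_nth// -cardE -TT' cardE index_mem.
by rewrite mem_enum.
Qed.

(** A random permutation sends a fixed set to a uniform set of its size: the sum over [pi] is the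
    same for all [T'] of that size, and for fixed [pi] these [T'] are permuted among themselves. *)
Lemma sum_perm_imset F T :
  'C(#|E|, #|T|)%:R * \sum_(pi : {perm E}) F (pi @: T) =
  #|{perm E}|%:R * \sum_(B : {set E} | #|B| == #|T|) F B.
Proof.
have hT T' : #|T'| == #|T| ->
    \sum_(pi : {perm E}) F (pi @: T') = \sum_(pi : {perm E}) F (pi @: T).
  move=> /eqP/esym/perm_imset_eq[rho ->].
  rewrite [RHS](reindex_inj (mulgI rho)); apply: eq_bigr => pi _; congr F.
  by rewrite -imset_comp; apply: eq_imset => x; rewrite /= permM.
have -> : 'C(#|E|, #|T|)%:R = \sum_(T' : {set E} | #|T'| == #|T|) 1 :> R.
  by rewrite -card_draws -sum1_card natr_sum; apply: eq_bigl => T'; rewrite inE.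
rewrite mulr_suml; under eq_bigr => T' T'n do rewrite mul1r -(hT _ T'n).
rewrite exchange_big/= -[#|{perm E}|]sum1_card natr_sum mulr_suml.
apply: eq_bigr => pi _.
rewrite mul1r [RHS](reindex_inj (imset_inj (@perm_inj _ pi)))/=.
by apply: eq_bigl => B; rewrite card_imset//; exact: perm_inj.
Qed.

(** The hypergeometric mean, without division; transpositions show that every point lies in equally
    many [n]-subsets. *)
Lemma sum_card_setI n D :
  (#|E| * (\sum_(B : {set E} | #|B| == n) #|B :&: D|) = #|D| * (n * 'C(#|E|, n)))%N.
Proof.
pose c v := (\sum_(B : {set E} | #|B| == n) (v \in B))%N.
have cc v w : c v = c w.
  rewrite /c [RHS](reindex_inj (imset_inj (@perm_inj _ (tperm v w)))).
  apply: eq_big => B; first by rewrite card_imset//; exact: perm_inj.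
  by rewrite -{1}(tpermL v w) mem_imset//; exact: perm_inj.
have sc (D' : {set E}) :
    (\sum_(B : {set E} | #|B| == n) #|B :&: D'| = \sum_(v in D') c v)%N.
  rewrite exchange_big/=; apply: eq_bigr => B _.
  rewrite -sum1_card big_mkcond [RHS]big_mkcond.
  by apply: eq_bigr => v _; rewrite inE; case: (v \in B) (v \in D') => -[].
have ct : (\sum_v c v = n * 'C(#|E|, n))%N.
  have := sc [set: E]%SET; under [X in _ = X -> _]eq_bigl do rewrite inE.
  move=> <-; rewrite (eq_bigr (fun=> n)) => [|B /eqP <-]; last by rewrite finset.setIT.
  rewrite sum_nat_const mulnC -card_draws; congr (_ * _)%N.
  by apply: eq_card => B; rewrite !inE.
have [->|/set0Pn[v0 _]] := eqVneq D finset.set0.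
  by rewrite cards0 mul0n big1 ?muln0// => B _; rewrite finset.setI0 cards0.
rewrite sc -ct (eq_bigr (fun=> c v0))// sum_nat_const.
by rewrite (eq_bigr (fun=> c v0))// sum_nat_const mulnCA.
Qed.
End Symmetrization.

(** * Iterated halving of the ground set *)

Section Halving.
Context {R : realType} {J : finType}.
Variables (t : R) (n r : nat) (delta : R).
Hypothesis t0 : 0 <= t.
Hypothesis n0 : (0 < n)%N.
Hypothesis nr : (n < 2 ^ r)%N.
Hypothesis delta01 : 0 < delta <= 1.

(* Closed form of [\sum_(i < k) 2 ^- i.+1 * K * (delta^-1 + 4 * (r + i))], with
   [K] the square root: the rounds contribute [2 ^- i / 2] times the bound of
   [rounding] for [n * 2 ^ i] sign variables. *)
Definition halving_bound (k : nat) : R :=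
  Num.sqrt (14 * t) * ((delta^-1 + 4 * r%:R) * (1 - (2 ^+ k)^-1) +
    4 * (1 - k.+1%:R / 2 ^+ k)).

Lemma halving_boundS k : halving_bound k.+1 = halving_bound k +
  (2 ^+ k)^-1 * (Num.sqrt (14 * t) * (delta^-1 + 4 * (r + k)%:R) / 2).
Proof.
rewrite /halving_bound -[k.+2]addn2 -[k.+1]addn1 !natrD exprD expr1; field.
by rewrite expf_neq0// andbT; case/andP: delta01 => /gt_eqF ->.
Qed.

(** [(2 ^+ k)^-1] is the density of [Q] when [E] has [n * 2 ^ k] points. *)
Definition balanced (E : finType) (a : J -> E -> R) (k : nat) (Q : {set E}) : Prop :=
  #|Q| = n /\ forall j,
    `|\sum_(e in Q) a j e - (2 ^+ k)^-1 * \sum_e a j e| <= halving_bound k.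

(** The kept points carry half of the total plus half of a signed sum of differences within pairs;
    later rounds scale this error by [(2 ^+ k)^-1]. *)
Lemma halving_step (k : nat) (E V : finType) (a : J -> E -> R) (g : V * bool -> E) y U' :
  bijective g ->
  (forall j, `|signed_sum (fun v => a j (g (v, false)) - a j (g (v, true))) y|
     <= Num.sqrt (14 * t) * (delta^-1 + 4 * (r + k)%:R)) ->
  balanced (fun j v => a j (g (v, y v))) k U' ->
  balanced a k.+1 [set g (v, y v) | v in U'].
Proof.
move=> gbij yb [U'n U'b].
have g_inj : {in U' &, injective (fun v => g (v, y v))}.
  by move=> v w _ _ /(bij_inj gbij)[].
split=> [|j]; first by rewrite card_in_imset.
rewrite big_imset//= halving_boundS.
have -> : \sum_e a j e = \sum_v (a j (g (v, false)) + a j (g (v, true))).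
  rewrite (reindex g)/=; last exact: onW_bij.
  rewrite [RHS](_ : _ = \sum_v \sum_b a j (g (v, b))); last first.
    by apply: eq_bigr => v _; rewrite big_bool addrC.
  by rewrite pair_bigA; apply: eq_bigr => -[].
have aE : \sum_v a j (g (v, y v)) =
    (\sum_v (a j (g (v, false)) + a j (g (v, true)))) / 2 +
    signed_sum (fun v => a j (g (v, false)) - a j (g (v, true))) y / 2.
  rewrite /signed_sum !mulr_suml -big_split/=; apply: eq_bigr => v _.
  by case: (y v); rewrite ?expr1 ?expr0; field.
have := U'b j; have := yb j; rewrite aE exprS invfM.
move: (signed_sum _ _) (\sum_(v in U') _) (\sum_v _) (Num.sqrt _ * _) => d q m w dw.
have p0 : 0 <= (2 ^+ k)^-1 :> R by rewrite invr_ge0 exprn_ge0.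
move: (_^-1) p0 => p p0 qm.
have -> : q - 2^-1 * p * m = (q - p * (m / 2 + d / 2)) + p * (d / 2) by field.
rewrite (le_trans (ler_normD _ _))// lerD// normrM (ger0_norm p0) ler_wpM2l//.
by rewrite normrM normfV normr_nat ler_wpM2r.
Qed.

(** A random pairing, a random sign vector [x] and a random [n]-subset [U] of the pairs give a
    uniform [n]-subset of [E]. Replacing [x] by its rounding costs [delta * n] points of overlap on
    average in each round. *)
Lemma halving (k : nat) (E : finType) (a : J -> E -> R) :
  (forall e, 4 * \sum_j a j e ^+ 2 <= t) -> #|E| = (n * 2 ^ k)%N ->
  exists Phi : {set E} -> {set E}, (forall B, balanced a k (Phi B)) /\
    'C(#|E|, n)%:R * (n%:R * (1 - k%:R * delta)) <=
      \sum_(B : {set E} | #|B| == n) #|Phi B :&: B|%:R.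
Proof.
elim: k E a => [|k IHk] E a at2 cE.
  rewrite expn0 muln1 in cE; exists (fun=> [set: E]%SET); split.
    move=> B; split=> [|j]; first by rewrite cardsT.
    have -> : halving_bound 0 = 0 by rewrite /halving_bound expr0 invr1; ring.
    rewrite expr0 invr1 mul1r.
    by under eq_bigl do rewrite inE; rewrite subrr normr0.
  rewrite mul0r subr0 mulr1.
  rewrite (eq_bigr (fun=> n%:R)) => [|B /eqP Bn]; last by rewrite finset.setTI Bn.
  rewrite sumr_const -(mulr_natl (n%:R)) -card_draws le_eqVlt; apply/orP; left.
  by apply/eqP; congr (_%:R * _); apply: eq_card => B; rewrite !inE.
pose m := (n * 2 ^ k)%N; pose V := 'I_m.
have m0 : (0 < m)%N by rewrite muln_gt0 n0 expn_gt0.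
have mr : (#|V| < 2 ^ (r + k))%N by rewrite card_ord expnD ltn_pmul2r// expn_gt0.
have [psi psi_bij] : exists psi : V * bool -> E, bijective psi.
  have cVE : #|{: V * bool}| = #|E| by rewrite card_prod card_ord card_bool cE expnSr mulnA.
  exists (fun p => enum_val (cast_ord cVE (enum_rank p))).
  apply: inj_card_bij; last by rewrite cVE.
  by move=> p q /enum_val_inj/cast_ord_inj/enum_rank_inj.
pose g (pi : {perm E}) p := pi (psi p).
have g_bij pi : bijective (g pi).
  by apply: bij_comp => //; exact: (injF_bij (@perm_inj _ pi)).
have /choice[y yP] : forall pi : {perm E}, exists y : {ffun V -> bool} -> {ffun V -> bool},
    (forall j x, `|signed_sum (fun v => a j (g pi (v, false)) - a j (g pi (v, true))) (y x)|
       <= Num.sqrt (14 * t) * (delta^-1 + 4 * (r + k)%:R)) /\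
    mean (fun x => (hamming x (y x))%:R : R) <= delta * #|V|%:R.
  move=> pi.
  apply: (rounding t0) => // v.
  have := at2 (g pi (v, false)); have := at2 (g pi (v, true)).
  (* The factor 4 in the hypothesis pays for passing to differences. *)
  suff : \sum_j (a j (g pi (v, false)) - a j (g pi (v, true))) ^+ 2 <=
    2 * \sum_j a j (g pi (v, false)) ^+ 2 + 2 * \sum_j a j (g pi (v, true)) ^+ 2 by lra.
  rewrite !mulr_sumr -big_split; apply: ler_sum => j _ /=.
  by have := sqr_ge0 (a j (g pi (v, false)) + a j (g pi (v, true))); lra.
have /choice[Psi PsiP] : forall q : {perm E} * {ffun V -> bool},
    exists Psi : {set V} -> {set V},
    (forall U, balanced (fun j v => a j (g q.1 (v, y q.1 q.2 v))) k (Psi U)) /\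
      'C(#|V|, n)%:R * (n%:R * (1 - k%:R * delta)) <=
      \sum_(U : {set V} | #|U| == n) #|Psi U :&: U|%:R.
  move=> q.
  by apply: IHk => [v|]; [exact: at2|rewrite card_ord].
pose emb (f : V * bool -> E) (x : {ffun V -> bool}) (U : {set V}) :=
  [set f (v, x v) | v in U]%SET.
pose Q (pi : {perm E}) (x : {ffun V -> bool}) U := emb (g pi) (y pi x) (Psi (pi, x) U).
have Qbal pi x U : balanced a k.+1 (Q pi x U).
  apply: halving_step => //; first by move=> j; exact: (proj1 (yP pi)).
  exact: (proj1 (PsiP (pi, x))).
pose good := [pred B : {set E} | `[< balanced a k.+1 B >]].
pose Q0 := Q 1%g [ffun=> false] finset.set0.
have Q0good : good Q0 by apply/asboolP; exact: Qbal.
(* [Phi] sees only [B], yet does at least as well as [Q pi x U] for every triple that produces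
   [B]. *)
pose Phi B := [arg max_(B' > Q0 | good B') #|B' :&: B|].
have PhiP B : balanced a k.+1 (Phi B) /\
    forall B', balanced a k.+1 B' -> (#|B' :&: B| <= #|Phi B :&: B|)%N.
  rewrite /Phi; case: arg_maxnP => // B' /asboolP B'b B'max; split => // B2 B2b.
  by apply: B'max; apply/asboolP.
exists Phi; split; first by move=> B; have [] := PhiP B.
pose D (pi : {perm E}) (x : {ffun V -> bool}) : {set V} := [set v | x v != y pi x v]%SET.
have cD pi x : #|D pi x| = hamming x (y pi x).
  rewrite /hamming -sum1_card big_mkcond/=; apply: eq_bigr => v _.
  by rewrite inE; case: (_ != _).
have cemb f (fi : bijective f) x U : #|emb f x U| = #|U|.
  by rewrite card_in_imset// => v w _ _ /(bij_inj fi)[].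
(* Where [x] and its rounding agree, a pair in both [Psi (pi, x) U] and [U] contributes the same
   point to both sets. *)
have overlap pi x U : (#|Psi (pi, x) U :&: U| <=
    #|Phi (pi @: emb psi x U) :&: (pi @: emb psi x U)| + #|U :&: D pi x|)%N.
  apply: leq_trans (_ : (#|Q pi x U :&: (pi @: emb psi x U)| +
    #|U :&: D pi x| <= _)%N); last first.
    by rewrite leq_add2r; exact: (proj2 (PhiP _)).
  rewrite -(cardsID (D pi x)) addnC leq_add//; last first.
    apply/subset_leq_card/fintype.subsetP => v.
    by rewrite !inE => /andP[/andP[_ ->] ->].
  rewrite -(cemb _ (g_bij pi) x); apply: subset_leq_card.
  apply/fintype.subsetP => _ /imsetP[v vin ->]; move: vin.
  rewrite !inE negbK => /andP[/eqP xy /andP[vP vU]]; apply/andP; split.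
    by rewrite xy; apply/imsetP; exists v.
  by apply/imsetP; exists (psi (v, x v)) => //; apply/imsetP; exists v.
set c := 'C(#|E|, n)%:R; set S := \sum_(B | _) _.
pose F (B : {set E}) : R := #|Phi B :&: B|%:R.
pose X : R := #|{: {ffun V -> bool}}|%:R; pose P : R := #|{perm E}|%:R.
pose Cm : R := 'C(#|V|, n)%:R.
have X0 : 0 < X by rewrite ltr0n; apply/card_gt0P; exists [ffun=> false].
have P0 : 0 < P by rewrite ltr0n; apply/card_gt0P; exists 1%g.
have Cm0 : 0 < Cm by rewrite ltr0n bin_gt0 card_ord leq_pmulr// expn_gt0.
(* [Tot] is evaluated exactly by symmetrization and bounded below for each [pi] by induction. *)
pose Tot := \sum_(pi : {perm E}) \sum_(x : {ffun V -> bool})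
  \sum_(U : {set V} | #|U| == n) F (pi @: emb psi x U).
have TotE : c * Tot = X * Cm * (P * S).
  rewrite /Tot exchange_big/= mulr_sumr (eq_bigr (fun=> Cm * (P * S))) => [|x _].
    by rewrite sumr_const -(mulr_natl (Cm * _)) mulrA.
  rewrite exchange_big/= mulr_sumr (eq_bigr (fun=> P * S)) => [|U /eqP Un].
    rewrite sumr_const -(mulr_natl (P * S)) /Cm -card_draws; congr (_%:R * _).
    by apply: eq_card => U; rewrite !inE.
  have /= := sum_perm_imset F (emb psi x U).
  by rewrite cemb// Un.
have mR : 0 < #|V|%:R :> R by rewrite ltr0n card_ord.
have Tot_ge (pi : {perm E}) : X * (Cm * (n%:R * (1 - k.+1%:R * delta))) <=
    \sum_(x : {ffun V -> bool}) \sum_(U : {set V} | #|U| == n) F (pi @: emb psi x U).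
  have le_x (x : {ffun V -> bool}) : Cm * (n%:R * (1 - k%:R * delta)) -
      n%:R * Cm / #|V|%:R * (hamming x (y pi x))%:R <=
      \sum_(U : {set V} | #|U| == n) F (pi @: emb psi x U).
    rewrite lerBlDr; apply: le_trans (proj2 (PsiP (pi, x))) _.
    have -> : n%:R * Cm / #|V|%:R * (hamming x (y pi x))%:R =
        \sum_(U : {set V} | #|U| == n) #|U :&: D pi x|%:R.
      apply: (mulfI (lt0r_neq0 mR)).
      rewrite -natr_sum -[in RHS]natrM sum_card_setI cD !natrM.
      by rewrite /Cm; field; exact: lt0r_neq0.
    rewrite -big_split/=; apply: ler_sum => U _; rewrite /F -natrD ler_nat.
    exact: overlap.
  apply: le_trans (ler_sum _ (fun x _ => le_x x)).
  rewrite sumrB sumr_const -(mulr_natl (Cm * _)) -mulr_sumr -/X.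
  have := proj2 (yP pi); rewrite /mean ler_pdivrMr// -/X => hs.
  have : n%:R * Cm / #|V|%:R * (\sum_x (hamming x (y pi x))%:R) <=
      n%:R * Cm / #|V|%:R * (delta * #|V|%:R * X).
    by rewrite ler_wpM2l// divr_ge0// mulr_ge0// ltW.
  have -> : n%:R * Cm / #|V|%:R * (delta * #|V|%:R * X) = n%:R * Cm * delta * X.
    by field; exact: lt0r_neq0.
  rewrite -[k.+1]addn1 natrD; lra.
have : P * (X * (Cm * (n%:R * (1 - k.+1%:R * delta)))) <= Tot.
  apply: le_trans (ler_sum _ (fun pi _ => Tot_ge pi)).
  by rewrite sumr_const -(mulr_natl (X * _)).
have c0 : 0 <= c by [].
move=> /(ler_wpM2l c0); rewrite TotE.
have -> : c * (P * (X * (Cm * (n%:R * (1 - k.+1%:R * delta))))) =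
  X * Cm * P * (c * (n%:R * (1 - k.+1%:R * delta))) by ring.
by rewrite [X in _ <= X](_ : _ = X * Cm * P * S) ?ler_pM2l ?mulr_gt0//; ring.
Qed.
End Halving.

(** * The expectation over the sample as a finite average *)

Lemma expectation_uniform_random_subset (R : realType) (d : measure_display)
    (Omega : measurableType d) (P : probability Omega R) (N n : nat)
    (S : Omega -> {set 'I_N}) (f : {set 'I_N} -> R) :
  (forall B, 0 <= f B) -> uniform_random_subset P n S ->
  ('E_P[fun w => f (S w)])%E =
    (('C(N, n)%:R)^-1 * \sum_(B : {set 'I_N} | #|B| == n) f B)%:E.
Proof.
move=> f0 [mS Sn PS]; rewrite unlock.
(* [f (S w)] is a finite combination of indicators of the events that [S] equals [B]. *)
have fSE w : (f (S w))%:E =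
    (\sum_(B <- seq.filter (fun B : {set 'I_N} => #|B| == n) (index_enum _))
    (f B)%:E * (\1_(S @^-1` [set B]%classic) w)%:E)%E.
  rewrite big_filter (bigD1 (S w))/=; last by rewrite Sn.
  rewrite indicE mem_set//= mule1 big1 ?adde0// => B /andP[_ BS].
  by rewrite indicE memNset ?mule0// => /esym/eqP; exact/negP.
under eq_integral do rewrite fSE.
rewrite ge0_integral_sum//; last first.
- by move=> B w _; rewrite mule_ge0// lee_fin.
- move=> B; apply: emeasurable_funM => //.
  by apply/measurable_realfun.measurable_EFinP; exact: measurable_realfun.measurable_indic.
rewrite big_filter EFinM muleC -sumEFin ge0_sume_distrl; last first.
  by move=> B _; rewrite lee_fin.
apply: eq_bigr => B /eqP Bn.
rewrite ge0_integralZl//; last first.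
- by rewrite lee_fin.
- by apply/measurable_realfun.measurable_EFinP; exact: measurable_realfun.measurable_indic.
rewrite integral_indic// setIT; congr (_ * _)%E.
exact: PS.
Qed.

(** * Numerical constants *)

Section Constants.
Context {R : realType}.

Lemma ln2_ge_half : 1 / 2 <= ln 2 :> R.
Proof.
rewrite -[leLHS]expRK ler_ln ?posrE ?expR_gt0//.
rewrite -[1 / 2 in leLHS]opprK expRN invf_ple ?posrE ?expR_gt0//.
by apply: le_trans (expR_ge1Dx _); lra.
Qed.

Lemma trunc_log_le_ln (n : nat) : (0 < n)%N ->
  (trunc_log 2 n).+1%:R <= 2 * ln (2 * n)%:R :> R.
Proof.
move=> n0; set l := trunc_log 2 n.
have : l.+1%:R * ln 2 <= ln (2 * n)%:R :> R.
  rewrite mulr_natl -lnXn// ler_ln ?posrE ?exprn_gt0 ?ltr0n ?muln_gt0//.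
  by rewrite -natrX ler_nat expnS leq_pmul2l// trunc_logP.
have := ln2_ge_half; have : 0 <= l.+1%:R :> R by [].
by move: (l.+1%:R : R) (ln 2 : R) (ln _ : R) => u v w; nra.
Qed.

(** 128 is 8 * 16: [Num.sqrt (56 * s)] is at most [8 * Num.sqrt s], and the other factor is at most
    [k / delta + 8 * l], where [l <= 2 * ln (2 * n)] is the bit length of [n]. *)
Lemma halving_bound_le (s n k : nat) (delta : R) :
  (0 < n)%N -> (0 < k)%N -> 0 < delta ->
  halving_bound (4 * s%:R) (trunc_log 2 n).+1 (delta / k%:R) k <=
    128 * Num.sqrt s%:R * (k%:R / delta + ln (2 * n)%:R).
Proof.
move=> n0 k0 d0; rewrite /halving_bound invf_div.
have K8 : Num.sqrt (14 * (4 * s%:R)) <= 8 * Num.sqrt s%:R :> R.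
  have -> : 8 * Num.sqrt s%:R = Num.sqrt (64 * s%:R) :> R.
    by rewrite sqrtrM// -[64]/((8 * 8)%:R) natrM -expr2 sqrtr_sqr normr_nat.
  by rewrite ler_wsqrtr//; have : 0 <= s%:R :> R by []; lra.
have := @trunc_log_le_ln n n0.
have l1 : 1 <= (trunc_log 2 n).+1%:R :> R by rewrite ler1n.
move: (_.+1%:R : R) l1 => l l1 lL.
have kd0 : 0 <= k%:R / delta :> R by rewrite divr_ge0// ltW.
have p0 : 0 <= (2 ^+ k)^-1 :> R by rewrite invr_ge0 exprn_ge0.
have kp0 : 0 <= k.+1%:R / 2 ^+ k :> R by rewrite divr_ge0// exprn_ge0.
have s0 : 0 <= Num.sqrt s%:R :> R by exact: sqrtr_ge0.
have -> : 128 * Num.sqrt s%:R * (k%:R / delta + ln (2 * n)%:R) =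
  (8 * Num.sqrt s%:R) * (16 * (k%:R / delta + ln (2 * n)%:R)) :> R by ring.
apply: (@le_trans _ _ (Num.sqrt (14 * (4 * s%:R)) * (16 * (k%:R / delta + ln (2 * n)%:R)))).
  rewrite ler_wpM2l ?sqrtr_ge0//.
  move: kd0 p0 kp0 lL; move: (k%:R / delta) ((2 ^+ k)^-1) (k.+1%:R / 2 ^+ k)
    (ln (2 * n)%:R) => u p q L *.
  nra.
by rewrite ler_wpM2r//; lra.
Qed.
End Constants.

(** * Assembly: [k] halving rounds with parameter [delta / k] *)

Unset Implicit Arguments.

Theorem theorem1p2 (R : realType) :
  exists2 C : R, 0 < C &
  forall (delta : R) (N n k D s : nat) (A : 'I_D -> {set 'I_N}),
    0 < delta < 1 ->
    (0 < n)%N -> (0 < k)%N -> N = (n * 2 ^ k)%N ->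
    sparse s A ->
    exists alg : randomized_algorithm R {set 'I_N} {set 'I_N},
      (* every output has size n and satisfies the discrepancy bound *)
      (forall (B : {set 'I_N}) (u : seed alg), #|B| = n ->
         let Q := output B u in
         #|Q| = n /\
         forall j : 'I_D,
           `| #|A j :&: Q|%:R / n%:R - #|A j|%:R / N%:R |
             <= C * (Num.sqrt s%:R / n%:R) * (k%:R / delta + ln (2 * n)%:R)) /\
      (* expected overlap, over the sample S and an independent seed U *)
      (forall (d : measure_display) (Omega : measurableType d)
          (P : probability Omega R)
          (S : Omega -> {set 'I_N}) (U : Omega -> seed alg),
         uniform_random_subset P n S ->
         has_law P U (seed_law alg) ->
         independent P S U ->
         ((n%:R * (1 - delta) - 2 * Num.sqrt n%:R)%:E
            <= 'E_P[fun w => #|output (S w) (U w) :&: S w|%:R])%E).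
Proof.
exists 128 => // delta N n k D s A /andP[d0 d1] n0 k0 NE sA.
have kR : 0 < k%:R :> R by rewrite ltr0n.
have nR : 0 < n%:R :> R by rewrite ltr0n.
have NR : N%:R = n%:R * 2 ^+ k :> R by rewrite NE natrM natrX.
pose a (j : 'I_D) (e : 'I_N) : R := (e \in A j)%:R.
(* For incidence vectors the squared column norm is the number of sets covering [e]. *)
have at2 e : 4 * \sum_j a j e ^+ 2 <= 4 * s%:R.
  rewrite ler_wpM2l//; apply: (@le_trans _ _ #|[pred j : 'I_D | e \in A j]|%:R).
    rewrite -sum1_card natr_sum [leRHS]big_mkcond/=; apply: ler_sum => j _.
    by rewrite /a inE; case: (e \in A j); rewrite ?expr1n ?expr0n.
  by rewrite ler_nat; exact: sA.
have d01 : 0 < delta / k%:R <= 1.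
  rewrite divr_gt0//= ler_pdivrMr// mul1r (le_trans (ltW d1))// ler1n//.
have cE : #|'I_N| = (n * 2 ^ k)%N by rewrite card_ord.
have [Phi [Phib PhiE]] := halving (mulr_ge0 (ler0n R 4) (ler0n R s)) n0
  (trunc_log_ltn n (isT : 1 < 2)%N) d01 at2 cE.
have mPhi (B : {set 'I_N}) (Y : set {set 'I_N}) :
    measurable ((fun _ : unit => Phi B) @^-1` Y).
  by [].
(* [Phi] already picks a best set for each input, so the seed space is a single point. *)
exists (RandomizedAlgorithm (dirac tt) mPhi) => /=; split.
  move=> B _ Bn; have [Qn Qb] := Phib B; split=> // j.
  have cA (Q : {set 'I_N}) : \sum_(e in Q) a j e = #|A j :&: Q|%:R.
    rewrite -sum1_card natr_sum big_mkcond [RHS]big_mkcond/=; apply: eq_bigr => e _.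
    by rewrite inE /a; case: (e \in A j) (e \in Q) => -[].
  have cA' : \sum_e a j e = #|A j|%:R.
    by rewrite -[A j]finset.setIT -cA; apply: eq_bigl => e; rewrite inE.
  have := Qb j; rewrite cA cA' => Qbj.
  have -> : #|A j :&: Phi B|%:R / n%:R - #|A j|%:R / N%:R =
      (#|A j :&: Phi B|%:R - (2 ^+ k)^-1 * #|A j|%:R) / n%:R :> R.
    by rewrite NR; field; rewrite gt_eqF//= expf_neq0.
  rewrite normrM normfV normr_nat.
  have -> : 128 * (Num.sqrt s%:R / n%:R) * (k%:R / delta + ln (2 * n)%:R) =
    128 * Num.sqrt s%:R * (k%:R / delta + ln (2 * n)%:R) / n%:R by ring.
  rewrite ler_wpM2r ?invr_ge0// (le_trans Qbj)//.
  exact: halving_bound_le.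
move=> d Omega P S U Sunif _ _.
rewrite (expectation_uniform_random_subset (f := fun B => #|Phi B :&: B|%:R) _ Sunif)//.
rewrite lee_fin.
have Cpos : 0 < 'C(N, n)%:R :> R.
  by rewrite ltr0n bin_gt0 NE leq_pmulr// expn_gt0.
rewrite ler_pdivlMl//; move: PhiE; rewrite card_ord; apply: le_trans.
(* The losses [delta / k] of the [k] rounds add up to [delta]. *)
rewrite ler_pM2l// [k%:R * _]mulrC divfK ?gt_eqF//.
by have := sqrtr_ge0 (n%:R : R); lra.
Qed.
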